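(* Let $X\in\mathbb{R}^{n\times p}$ be deterministic with $\|X_j\|_2^2=n$ for all $j\in[p]$, let $\beta^*\in\mathbb{R}^p$ have support $S$ with $|S|=s$, let $\sigma>0$, and let $y=X\beta^*+\varepsilon$ with $\varepsilon\sim\mathcal{N}(0,\sigma^2I_n)$. Assume that $X$ satisfies the restricted eigenvalue condition RE($3$, $s$), and let $\lambda=6\sigma\sqrt{2\log(p/\delta)/n}$ for some $\delta\in(0,1)$. Let $\hat\beta$ be a Lasso solution with tuning parameter $\lambda$ and let $\bar\beta$ be a sign-consistent refitting of $\hat\beta$. Then with probability at least $1-\delta$, $$\frac1n\|X(\beta^*-\bar\beta)\|_2^2+\frac1n\|X(\beta^*-\hat\beta)\|_2^2\le\lambda^2s\Big(\frac{9}{\kappa^2(3,s)}+\frac{16}{\kappa^2(1,s)}\Big).$$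
   Context: $[p]=\{1,\dots,p\}$; $X_j$ is the $j$-th column of $X$; for $J\subset[p]$, $\Delta_J$ is the subvector of $\Delta$ indexed by $J$ and $J^c=[p]\setminus J$. A Lasso solution with tuning parameter $\lambda>0$ is any $\hat\beta\in\arg\min_{\beta\in\mathbb{R}^p}\frac{1}{2n}\|y-X\beta\|_2^2+\lambda\|\beta\|_1$. The set-valued map $\mathrm{sign}$ is the subdifferential of the $\ell_1$-norm: $\mathrm{sign}(\beta)_j=\{1\}$ if $\beta_j>0$, $\{-1\}$ if $\beta_j<0$, $[-1,1]$ if $\beta_j=0$. A vector $\bar\beta=\bar\beta(\hat\beta,X,y)$ is a sign-consistent refitting of the Lasso solution $\hat\beta$ (with parameter $\lambda$) if $\|y-X\bar\beta\|_2\le\|y-X\hat\beta\|_2$ and $\frac1nX^\top(y-X\hat\beta)\in\lambda\,\mathrm{sign}(\bar\beta)$. $X$ satisfies RE($c_0$, $s$), where $c_0>0$ and $s\in[p]$, if there is a constant $\kappa(c_0,s)>0$ such that for all $J\subset[p]$ with $|J|\le s$ and all $\Delta\in\mathbb{R}^p$ (nonzero on $J$), $\|\Delta_{J^c}\|_1\le c_0\|\Delta_J\|_1$ implies $\frac{\|X\Delta\|_2^2}{n\|\Delta_J\|_2^2}\ge\kappa^2(c_0,s)$. RE($3$, $s$) implies RE($1$, $s$); $\kappa(3,s)$ and $\kappa(1,s)$ denote such constants. *)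

(* Defs.v *)
From HB Require Import structures.
From mathcomp Require Import all_boot all_order all_algebra.
From mathcomp Require Import all_classical all_reals all_analysis.
Set Implicit Arguments.
Unset Strict Implicit.
Unset Printing Implicit Defensive.
Import Order.TTheory GRing.Theory Num.Theory.
Import numFieldNormedType.Exports.
Local Open Scope classical_set_scope.
Local Open Scope ring_scope.

(* The library norm on matrices is the sup norm, hence these two. *)
Definition l1norm (R : realType) (m : nat) (v : 'cV[R]_m) : R :=
  \sum_(i < m) `|v i 0|.

Definition l2norm (R : realType) (m : nat) (v : 'cV[R]_m) : R :=
  Num.sqrt (\sum_(i < m) v i 0 ^+ 2).

Definition supp (R : realType) (p : nat) (b : 'cV[R]_p) : {set 'I_p} :=
  finset (fun j => b j 0 != 0).

(* The subvector indexed by J is encoded by extending it by zero outside J,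
   which changes neither its norms nor whether it vanishes. *)
Definition subvec (R : realType) (p : nat) (J : {set 'I_p}) (D : 'cV[R]_p) :
    'cV[R]_p :=
  \col_(j < p) (if j \in J then D j 0 else 0).

Definition lasso_objective (R : realType) (n p : nat) (X : 'M[R]_(n, p))
    (y : 'cV[R]_n) (lambda : R) (b : 'cV[R]_p) : R :=
  1 / (2 * n%:R) * l2norm (y - X *m b) ^+ 2 + lambda * l1norm b.

Definition lasso_solution (R : realType) (n p : nat) (X : 'M[R]_(n, p))
    (y : 'cV[R]_n) (lambda : R) (bhat : 'cV[R]_p) : Prop :=
  forall b : 'cV[R]_p,
    lasso_objective X y lambda bhat <= lasso_objective X y lambda b.

Definition sign_coord (R : realType) (x : R) : set R :=
  if 0 < x then [set 1] else if x < 0 then [set -1] else `[-1, 1]%classic.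

Definition sign_map (R : realType) (p : nat) (b : 'cV[R]_p) : set 'cV[R]_p :=
  [set z | forall j : 'I_p, sign_coord (b j 0) (z j 0)].

Definition sign_consistent_refitting (R : realType) (n p : nat)
    (X : 'M[R]_(n, p)) (y : 'cV[R]_n) (lambda : R) (bhat bbar : 'cV[R]_p)
    : Prop :=
  l2norm (y - X *m bbar) <= l2norm (y - X *m bhat) /\
  [set lambda *: z | z in sign_map bbar]
    (n%:R^-1 *: (X^T *m (y - X *m bhat))).

(* X satisfies RE(c0, s) with constant kappa; RE(c0, s) itself is the existence
   of such a kappa. *)
Definition RE_with (R : realType) (n p : nat) (X : 'M[R]_(n, p)) (c0 : R)
    (s : nat) (kappa : R) : Prop :=
  0 < kappa /\
  forall (J : {set 'I_p}) (D : 'cV[R]_p),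
    (#|J| <= s)%N -> subvec J D != 0 ->
    l1norm (subvec (~: J)%SET D) <= c0 * l1norm (subvec J D) ->
    kappa ^+ 2 <= l2norm (X *m D) ^+ 2 / (n%:R * l2norm (subvec J D) ^+ 2).

Definition mutually_independent (d : measure_display) (T : measurableType d)
    (R : realType) (P : probability T R) (m : nat) (Z : 'I_m -> {RV P >-> R})
    : Prop :=
  forall (J : {set 'I_m}) (B : 'I_m -> set R),
    (forall i, measurable (B i)) ->
    P (\bigcap_(i in [set i | i \in J]) (Z i @^-1` B i)) =
    (\prod_(i in J) P (Z i @^-1` B i))%E.

(* Coordinates of a vector with law N(0, sigma^2 I_m), sigma > 0; the second
   parameter of normal_prob is the standard deviation. *)
Definition isotropic_gaussian (d : measure_display) (T : measurableType d)
    (R : realType) (P : probability T R) (m : nat) (sigma : R)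
    (eps : 'I_m -> {RV P >-> R}) : Prop :=
  mutually_independent eps /\
  forall (i : 'I_m) (B : set R), measurable B ->
    distribution P (eps i) B = normal_prob 0 sigma B.

Definition rvec (d : measure_display) (T : measurableType d)
    (R : realType) (P : probability T R) (m : nat) (eps : 'I_m -> {RV P >-> R})
    (w : T) : 'cV[R]_m := \col_(i < m) eps i w.

(* Inner probability of E is at least q; for measurable E this is q <= P E.
   E need not be measurable, as solutions of an optimization problem may be
   selected non-measurably in w. *)
Definition with_prob_at_least (d : measure_display) (T : measurableType d)
    (R : realType) (P : probability T R) (q : R) (E : set T) : Prop :=
  exists2 A : set T, measurable A /\ A `<=` E & (q%:E <= P A)%E.

(* Main.v *)
(* Write h = betahat - betastar, g = betabar - betastar and work on the event
   where every |X_j^T eps| is at most n lambda / 6. Optimality of the Lasso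
   against betastar, the sign condition on betabar and the residual inequality
   together give
     (|X g|^2 + |X h|^2) / n <= 2 lambda (|h_S|_1 - |h_S^c|_1) + 2 <eps, X g> / n.
   Either |g_S^c|_1 <= 3 |g_S|_1, and RE(3, s) controls the noise term through
   |g|_1 <= 4 |g_S|_1; or the sign condition forces
   2 <eps, X g> <= - <X g, X h> <= (|X g|^2 + |X h|^2) / 2, which is absorbed in
   the left-hand side. The term in h is positive only if |h_S^c|_1 <= |h_S|_1,
   where RE(1, s) applies.

   The event has probability at least 1 - delta by a union bound: X_j^T eps has
   law N(0, n sigma^2), and the tail bound needed is exactly exp(- t^2 / 2),
   without the factor 2 of a Chernoff bound, since p may be 1 and delta close
   to 1. *)
Require Import Defs.
From HB Require Import structures.
From mathcomp Require Import all_boot all_order all_algebra.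
From mathcomp Require Import all_classical all_reals all_analysis.
From mathcomp Require Import measurable_realfun.
From mathcomp Require Import ring lra.
Set Implicit Arguments.
Unset Strict Implicit.
Unset Printing Implicit Defensive.
Import Order.TTheory GRing.Theory Num.Theory.
Import numFieldNormedType.Exports.
Local Open Scope classical_set_scope.
Local Open Scope ring_scope.

(** * Inner products and the norms of subvectors *)

Definition dot (R : realType) (m : nat) (u v : 'cV[R]_m) : R :=
  \sum_(i < m) u i 0 * v i 0.

Lemma dotC (R : realType) m (u v : 'cV[R]_m) : dot u v = dot v u.
Proof. by apply: eq_bigr => i _; rewrite mulrC. Qed.

Lemma dotDl (R : realType) m (u v w : 'cV[R]_m) :
  dot (u + v) w = dot u w + dot v w.
Proof. by rewrite /dot -big_split; apply: eq_bigr => i _; rewrite mxE mulrDl. Qed.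

Lemma dotDr (R : realType) m (u v w : 'cV[R]_m) :
  dot w (u + v) = dot w u + dot w v.
Proof. by rewrite dotC dotDl !(dotC w). Qed.

Lemma dotZl (R : realType) m (a : R) (u v : 'cV[R]_m) :
  dot (a *: u) v = a * dot u v.
Proof. by rewrite /dot mulr_sumr; apply: eq_bigr => i _; rewrite mxE mulrA. Qed.

Lemma dotZr (R : realType) m (a : R) (u v : 'cV[R]_m) :
  dot u (a *: v) = a * dot u v.
Proof. by rewrite dotC dotZl dotC. Qed.

Lemma dotNl (R : realType) m (u v : 'cV[R]_m) : dot (- u) v = - dot u v.
Proof. by rewrite -scaleN1r dotZl mulN1r. Qed.

Lemma dotNr (R : realType) m (u v : 'cV[R]_m) : dot u (- v) = - dot u v.
Proof. by rewrite dotC dotNl dotC. Qed.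

Lemma dotvv_ge0 (R : realType) m (u : 'cV[R]_m) : 0 <= dot u u.
Proof. by apply: sumr_ge0 => i _; rewrite -expr2 sqr_ge0. Qed.

Lemma dot_mulmx_trmx (R : realType) n p (X : 'M[R]_(n, p))
    (u : 'cV[R]_n) (v : 'cV[R]_p) :
  dot (X^T *m u) v = dot u (X *m v).
Proof.
have dotE m (a b : 'cV[R]_m) : dot a b = (a^T *m b) 0 0.
  by rewrite mxE; apply: eq_bigr => i _; rewrite mxE.
by rewrite !dotE trmx_mul trmxK mulmxA.
Qed.

Lemma sqr_l2norm (R : realType) m (v : 'cV[R]_m) : l2norm v ^+ 2 = dot v v.
Proof.
rewrite /l2norm sqr_sqrtr; first by apply: eq_bigr => i _; rewrite expr2.
by apply: sumr_ge0 => i _; rewrite sqr_ge0.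
Qed.

Lemma l2norm_ge0 (R : realType) m (v : 'cV[R]_m) : 0 <= l2norm v.
Proof. exact: sqrtr_ge0. Qed.

Lemma l1norm_subvec (R : realType) p (J : {set 'I_p}) (v : 'cV[R]_p) :
  l1norm (subvec J v) = \sum_(j in J) `|v j 0|.
Proof.
rewrite /l1norm [RHS]big_mkcond; apply: eq_bigr => j _.
by rewrite mxE; case: ifP; rewrite ?normr0.
Qed.

Lemma l1norm_ge0 (R : realType) p (v : 'cV[R]_p) : 0 <= l1norm v.
Proof. exact: sumr_ge0. Qed.

Lemma l1norm_split (R : realType) p (J : {set 'I_p}) (v : 'cV[R]_p) :
  l1norm v = l1norm (subvec J v) + l1norm (subvec (~: J)%SET v).
Proof.
rewrite !l1norm_subvec /l1norm (bigID (mem J))/=; congr (_ + _).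
by apply: eq_bigl => j; rewrite inE.
Qed.

Lemma l1norm_convex (R : realType) p (t : R) (u v : 'cV[R]_p) :
  0 <= t <= 1 -> l1norm (u + t *: (v - u)) <= (1 - t) * l1norm u + t * l1norm v.
Proof.
move=> /andP[t0 t1]; rewrite /l1norm !mulr_sumr -big_split/=.
apply: ler_sum => i _; rewrite !mxE.
have -> : u i 0 + t * (v i 0 - u i 0) = (1 - t) * u i 0 + t * v i 0 by ring.
rewrite (le_trans (ler_normD _ _))// !normrM (ger0_norm t0) ger0_norm//.
by rewrite subr_ge0.
Qed.

(** Cauchy-Schwarz on J through the Lagrange identity: the double sum over J of (|v_i| - |v_j|)^2 is
    nonnegative and equals twice the gap between the two sides. *)
Lemma sqr_l1norm_subvec_le (R : realType) p (J : {set 'I_p}) (v : 'cV[R]_p) :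
  l1norm (subvec J v) ^+ 2 <= #|J|%:R * l2norm (subvec J v) ^+ 2.
Proof.
rewrite l1norm_subvec sqr_l2norm.
have -> : dot (subvec J v) (subvec J v) = \sum_(j in J) `|v j 0| ^+ 2.
  rewrite /dot [RHS]big_mkcond; apply: eq_bigr => j _.
  by rewrite !mxE; case: ifP; rewrite ?mulr0// real_normK ?num_real// expr2.
set w := fun j : 'I_p => `|v j 0|.
rewrite -/(\sum_(j in J) w j) -/(\sum_(j in J) w j ^+ 2).
suff : 0 <= \sum_(i in J) \sum_(j in J) (w i - w j) ^+ 2.
  have -> : \sum_(i in J) \sum_(j in J) (w i - w j) ^+ 2 =
      2 * (#|J|%:R * \sum_(j in J) w j ^+ 2 - (\sum_(j in J) w j) ^+ 2).
    transitivity (\sum_(i in J) (#|J|%:R * w i ^+ 2 + \sum_(j in J) w j ^+ 2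
                    - 2 * w i * \sum_(j in J) w j)).
      apply: eq_bigr => i _.
      transitivity (\sum_(j in J) (w i ^+ 2 + w j ^+ 2) -
                    \sum_(j in J) 2 * w i * w j).
        by rewrite -sumrB; apply: eq_bigr => j _; ring.
      by rewrite big_split/= sumr_const -[_ *+ #|J|]mulr_natl -mulr_sumr.
    rewrite sumrB big_split/= -!mulr_sumr -mulr_suml sumr_const -mulr_natl.
    by rewrite -mulr_sumr; ring.
  by rewrite pmulr_rge0// subr_ge0.
by apply: sumr_ge0 => i _; apply: sumr_ge0 => j _; exact: sqr_ge0.
Qed.

(** * Optimality of the Lasso, sign conditions and restricted eigenvalues *)

(** Replaces a limit t -> 0: if a > 0, then t = 1 forces b >= a, so t = a / (2 b) is admissible and
    gives a <= a / 2. *)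
Lemma le0_small_linear (R : realFieldType) (a b : R) :
  (forall t, 0 < t <= 1 -> a <= t * b) -> a <= 0.
Proof.
move=> h; rewrite leNgt; apply/negP => a0.
have b0 : a <= b by rewrite -[b]mul1r h// ltr01 lexx.
have bp : 0 < b by exact: lt_le_trans b0.
have := h (a / (2 * b)).
rewrite divr_gt0 ?mulr_gt0//= ler_pdivrMr ?mulr_gt0// => /(_ _).
have -> : a / (2 * b) * b = a / 2 by field; rewrite gt_eqF.
lra.
Qed.

(* Compare [bhat] with [bhat + t (b - bhat)] and let t tend to 0. *)
Lemma lasso_variational (R : realType) n p (X : 'M[R]_(n, p)) (y : 'cV[R]_n)
    (lambda : R) (bhat b : 'cV[R]_p) :
  (0 < n)%N -> 0 <= lambda -> lasso_solution X y lambda bhat ->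
  dot (y - X *m bhat) (X *m (b - bhat)) <=
    n%:R * lambda * (l1norm b - l1norm bhat).
Proof.
move=> n0 l0 opt; have n0' : 0 < n%:R :> R by rewrite ltr0n.
rewrite -subr_le0.
(* The error term is the second-order part of the loss along the segment, left over after division
   by t / n. *)
apply: (@le0_small_linear _ _ (dot (X *m (b - bhat)) (X *m (b - bhat)) / 2)).
move=> t /andP[t0 t1].
have := opt (bhat + t *: (b - bhat)); rewrite /lasso_objective.
have -> : y - X *m (bhat + t *: (b - bhat)) =
    (y - X *m bhat) - t *: (X *m (b - bhat)).
  by rewrite mulmxDr -scalemxAr opprD addrA.
set r := y - _; set q := X *m _; move: r q => r q.
rewrite !sqr_l2norm dotDl !dotDr !dotNl !dotNr !dotZl !dotZr (dotC q r).
have := @l1norm_convex _ _ t bhat b; rewrite (ltW t0) t1 => /(_ isT).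
move=> /(ler_wpM2l l0) convex opt_t.
have : 0 <= 1 / (2 * n%:R) * (- (2 * t * dot r q) + t ^+ 2 * dot q q)
           + lambda * (t * (l1norm b - l1norm bhat)).
  set c := 1 / _ in opt_t *.
  by nra.
have -> : 1 / (2 * n%:R) * (- (2 * t * dot r q) + t ^+ 2 * dot q q)
           + lambda * (t * (l1norm b - l1norm bhat)) =
   t / n%:R * (t * (dot q q / 2) - (dot r q - n%:R * lambda * (l1norm b - l1norm bhat))).
  by field; rewrite gt_eqF.
by rewrite pmulr_rge0 ?divr_gt0// subr_ge0.
Qed.

Lemma dot_le_sup_l1norm (R : realType) p (c : R) (u v : 'cV[R]_p) :
  (forall j, `|u j 0| <= c) -> dot u v <= c * l1norm v.
Proof.
move=> uc; rewrite /dot /l1norm mulr_sumr; apply: ler_sum => j _.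
by rewrite (le_trans (ler_norm _))// normrM ler_wpM2r.
Qed.

(** On the support of [b0] this is the triangle inequality; off it [b0] vanishes, so [b] and
    [b - b0] have the same coordinates. *)
Lemma l1norm_diff_supp (R : realType) p (b0 b : 'cV[R]_p) :
  l1norm b0 - l1norm b <=
    l1norm (subvec (supp b0) (b - b0)) - l1norm (subvec (~: supp b0)%SET (b - b0)).
Proof.
rewrite !l1norm_subvec /l1norm -sumrB (bigID (mem (supp b0)))/=.
apply: lerD.
  apply: ler_sum => j _; rewrite !mxE lerBlDl.
  by rewrite -{1}(subKr (b j 0) (b0 j 0)) ler_normB.
rewrite -sumrN (eq_bigl (fun j => j \in (~: supp b0)%SET)); last first.
  by move=> j; rewrite finset.in_setC.
apply: ler_sum => j; rewrite !inE negbK => /eqP bj0.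
by rewrite !mxE bj0 subr0 normr0 sub0r.
Qed.

(** Separates the two ways in which a subgradient enters below: the bound serves on the support of
    the reference vector, the alignment off it. *)
Lemma sign_coordP (R : realType) (x z : R) :
  sign_coord x z -> `|z| <= 1 /\ z * x = `|x|.
Proof.
rewrite /sign_coord; case: ltP => [x0 /= ->|x0].
  by rewrite normr1 mul1r gtr0_norm.
case: ltP => [x1 /= ->|x1]; first by rewrite normrN1 mulN1r ltr0_norm.
have -> : x = 0 by apply/eqP; rewrite eq_le x0 x1.
by rewrite /= in_itv/= mulr0 normr0 ler_norml.
Qed.

(** On the support of [b0] only |z_j| <= 1 is available; off it (b - b0)_j = b_j, and z_j b_j =
    |b_j| recovers the full norm. *)
Lemma sign_map_supp (R : realType) p (b0 b z : 'cV[R]_p) : sign_map b z ->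
  l1norm (subvec (~: supp b0)%SET (b - b0)) - l1norm (subvec (supp b0) (b - b0))
    <= dot z (b - b0).
Proof.
move=> zb; rewrite !l1norm_subvec /dot addrC [leRHS](bigID (mem (supp b0)))/=.
apply: lerD.
  rewrite -sumrN; apply: ler_sum => j _.
  rewrite lerNl (le_trans (ler_norm _))// normrN normrM ler_piMl//.
  by have [] := sign_coordP (zb j).
rewrite (eq_bigl (fun j => j \notin supp b0)); last by move=> j; rewrite finset.in_setC.
apply: ler_sum => j; rewrite inE negbK => /eqP bj0.
by rewrite !mxE bj0 subr0; have [_ ->] := sign_coordP (zb j).
Qed.

(** The eigenvalue condition controls the l2 norm on J, and Cauchy-Schwarz passes to the l1 norm at
    the price of the factor s. When [D] vanishes on J, [RE_with] is silent but the left-hand side is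
    0. *)
Lemma RE_l1norm (R : realType) n p (X : 'M[R]_(n, p)) (c : R) s (kappa : R)
    (J : {set 'I_p}) (D : 'cV[R]_p) :
  (0 < n)%N -> RE_with X c s kappa -> (#|J| <= s)%N ->
  l1norm (subvec (~: J)%SET D) <= c * l1norm (subvec J D) ->
  l1norm (subvec J D) ^+ 2 <= s%:R / kappa ^+ 2 * (dot (X *m D) (X *m D) / n%:R).
Proof.
move=> n0 [k0 re] Js cone; have n0' : 0 < n%:R :> R by rewrite ltr0n.
have [J0|J0] := eqVneq (subvec J D) 0.
  rewrite J0 (_ : l1norm _ = 0); last first.
    by apply: big1 => i _; rewrite mxE normr0.
  by rewrite expr0n/= mulr_ge0// divr_ge0 ?exprn_ge0 ?dotvv_ge0 ?ler0n// ltW.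
have := re _ _ Js J0 cone; rewrite sqr_l2norm.
have q0 : 0 < l2norm (subvec J D) ^+ 2.
  rewrite lt_neqAle sqr_ge0 andbT eq_sym; apply: contra J0.
  rewrite sqr_l2norm => /eqP d0; apply/eqP/matrixP => i k; rewrite ord1 [RHS]mxE.
  have /eqP := d0; rewrite psumr_eq0 => [/allP /(_ i)|j _]; last first.
    by rewrite -expr2 sqr_ge0.
  by rewrite mem_index_enum => /(_ isT); rewrite -expr2 sqrf_eq0 => /eqP.
rewrite ler_pdivlMr ?(mulr_gt0 n0' q0)// => kq.
rewrite (le_trans (sqr_l1norm_subvec_le _ _))//.
apply: (@le_trans _ _ (s%:R * l2norm (subvec J D) ^+ 2)).
  by rewrite ler_wpM2r ?sqr_ge0 ?ler_nat.
rewrite -mulrA ler_wpM2l// mulrC ler_pdivlMr ?exprn_gt0// ler_pdivlMr//.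
by rewrite -mulrA mulrC -mulrA.
Qed.

(** Expand (x - c w)^2 >= 0. The factor 1/2 on a allows a prediction error to be absorbed later. *)
Lemma le_amgm (R : realFieldType) (w a x c : R) :
  0 < w -> x ^+ 2 <= w * a -> c * x <= a / 2 + c ^+ 2 * w / 2.
Proof.
move=> w0 xa; rewrite -(ler_pM2l w0).
have := sqr_ge0 (x - c * w); nra.
Qed.

(** * The deterministic bound under small noise correlations *)

Lemma refitting_bound (R : realType) n p s (X : 'M[R]_(n, p))
    (betastar betahat betabar : 'cV[R]_p) (e : 'cV[R]_n)
    (lambda kappa3 kappa1 : R) :
  (0 < n)%N -> (0 < s)%N -> #|supp betastar| = s -> 0 <= lambda ->
  RE_with X 3 s kappa3 -> RE_with X 1 s kappa1 ->
  lasso_solution X (X *m betastar + e) lambda betahat ->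
  sign_consistent_refitting X (X *m betastar + e) lambda betahat betabar ->
  (forall j, `|(X^T *m e) j 0| <= n%:R * lambda / 6) ->
  1 / n%:R * l2norm (X *m (betastar - betabar)) ^+ 2
  + 1 / n%:R * l2norm (X *m (betastar - betahat)) ^+ 2
  <= lambda ^+ 2 * s%:R * (9 / kappa3 ^+ 2 + 16 / kappa1 ^+ 2).
Proof.
move=> n0 s0 cS l0 re3 re1 lasso [ref_le [z zbar]] + noise.
have n0' : 0 < n%:R :> R by rewrite ltr0n.
set r := X *m betastar + e - X *m betahat => KKT.
set h := betahat - betastar; set g := betabar - betastar.
have rE : r = e - X *m h by rewrite /r /h mulmxBr opprB addrCA addrA.
have bE : X *m betastar + e - X *m betabar = e - X *m g.
  by rewrite /g mulmxBr opprB addrCA addrA.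
have SSs : (#|supp betastar| <= s)%N by rewrite cS.
have vi := lasso_variational betastar n0 l0 lasso; rewrite -/r in vi.
have hl := l1norm_diff_supp betastar betahat; rewrite -/h in hl.
have gl := sign_map_supp betastar zbar; rewrite -/g in gl.
have := RE_l1norm (D := g) n0 re3 SSs; have := RE_l1norm (D := h) n0 re1 SSs.
have eg : dot e (X *m g) <= n%:R * lambda / 6 * l1norm g.
  by rewrite -dot_mulmx_trmx; exact: dot_le_sup_l1norm.
move: eg; rewrite (l1norm_split (supp betastar) g).
(* By the sign condition lambda z = X^T r / n, so pairing with g turns z into the Lasso residual. *)
have zg : n%:R * lambda * dot z g = dot r (X *m g).
  by rewrite -dot_mulmx_trmx -mulrA -dotZl KKT dotZl mulrA divff ?gt_eqF// mul1r.
have : 0 <= n%:R * lambda by rewrite mulr_ge0// ltW.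
move/ler_wpM2l => nl; move: vi => /le_trans /(_ (nl _ _ hl)).
move: {nl}(nl _ _ gl); rewrite zg rE -(opprB betahat) -/h mulmxN dotNr.
rewrite -[betastar - betabar]opprB -/g mulmxN.
have norm_ref : l2norm (e - X *m g) ^+ 2 <= l2norm (e - X *m h) ^+ 2.
  by rewrite lerXn2r ?nnegrE ?l2norm_ge0// -bE -rE.
move: norm_ref; rewrite !sqr_l2norm !(dotDl, dotDr, dotNl, dotNr) !opprK.
have := dotvv_ge0 (X *m g + X *m h); rewrite !(dotDl, dotDr).
rewrite (dotC (X *m h) (X *m g)) !(dotC _ e).
have := dotvv_ge0 (X *m g); have := dotvv_ge0 (X *m h).
have := l1norm_ge0 (subvec (supp betastar) h).
have := l1norm_ge0 (subvec (~: supp betastar)%SET h).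
have := l1norm_ge0 (subvec (supp betastar) g).
have := l1norm_ge0 (subvec (~: supp betastar)%SET g).
(* From here on only real numbers are involved: [A], [B], [C] stand for |X g|^2, |X h|^2 and <X g, X
   h>, and [ABC] records |X g + X h|^2 >= 0. *)
move: (l1norm (subvec (~: supp betastar)%SET g)) (l1norm (subvec (supp betastar) g))
  (l1norm (subvec (~: supp betastar)%SET h)) (l1norm (subvec (supp betastar) h))
  (dot (X *m g) (X *m g)) (dot (X *m h) (X *m h)) (dot (X *m g) (X *m h))
  (dot e (X *m g)) (dot e (X *m h)) (dot e e) => gSc gS hSc hS A B C eg eh ee.
move=> gSc0 gS0 hSc0 hS0 B0 A0 ABC ref gKKT hVI egle REh REg.
have [k3 _] := re3; have [k1 _] := re1.
have w3 : 0 < s%:R / kappa3 ^+ 2 by rewrite divr_gt0 ?exprn_gt0 ?ltr0n.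
have w1 : 0 < s%:R / kappa1 ^+ 2 by rewrite divr_gt0 ?exprn_gt0 ?ltr0n.
have -> : lambda ^+ 2 * s%:R * (9 / kappa3 ^+ 2 + 16 / kappa1 ^+ 2) =
  lambda ^+ 2 * (9 * (s%:R / kappa3 ^+ 2) + 16 * (s%:R / kappa1 ^+ 2)) by field; rewrite !gt_eqF.
move: (s%:R / kappa3 ^+ 2) (s%:R / kappa1 ^+ 2) w3 w1 REh REg => w3 w1 w30 w10 REh REg.
(* Each inner product is written as n times a normalised one, so that n cancels and no division is
   left in the constraints. *)
have scaled (u : R) : {v | u = n%:R * v}.
  by exists (u / n%:R); rewrite mulrCA divff ?mulr1// gt_eqF.
have [a AE] := scaled A; have [b BE] := scaled B; have [c CE] := scaled C.
have [x egE] := scaled eg; have [x' ehE] := scaled eh.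
rewrite {}AE {}BE {}CE {}egE {}ehE in A0 B0 ABC ref gKKT hVI egle REh REg *.
move: n0' A0 B0 ABC ref gKKT hVI egle REh REg.
move: (n%:R : R) => N N0.
have divK u : N * u / N = u by field; rewrite gt_eqF.
have mulK u : 1 / N * (N * u) = u by field; rewrite gt_eqF.
rewrite !divK !mulK !(pmulr_rge0 _ N0) => a0 b0 ABC ref gKKT hVI egle REh REg.
have {}ABC : 0 <= a + c + (c + b) by rewrite -(pmulr_rge0 _ N0); nra.
have {}ref : a - 2 * x <= b - 2 * x' by rewrite -(ler_pM2l N0); nra.
have {}gKKT : lambda * (gSc - gS) <= x - c by rewrite -(ler_pM2l N0); nra.
have {}hVI : b - x' <= lambda * (hS - hSc) by rewrite -(ler_pM2l N0); nra.
have {}egle : x <= lambda / 6 * (gS + gSc) by rewrite -(ler_pM2l N0); nra.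
have lw3 : 0 <= lambda ^+ 2 * w3 by rewrite mulr_ge0 ?sqr_ge0 ?ltW.
have lw1 : 0 <= lambda ^+ 2 * w1 by rewrite mulr_ge0 ?sqr_ge0 ?ltW.
(* The residual inequality plus twice the optimality inequality; the terms in [x'] cancel. *)
have sum_le : a + b <= 2 * (lambda * (hS - hSc)) + 2 * x by lra.
(* The multiple k is kept free: 2 is needed inside the cone for g, and 4 outside it. *)
have h_le k : 0 <= k ->
    k * (lambda * (hS - hSc)) <= b / 2 + k ^+ 2 * (lambda ^+ 2 * w1) / 2.
  move=> k0; have [hh|hh] := leP hSc (1 * hS).
    have := le_amgm (k * lambda) w10 (REh hh).
    by have := mulr_ge0 (mulr_ge0 k0 l0) hSc0; nra.
  have : k * lambda * (hS - hSc) <= 0.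
    by rewrite mulr_ge0_le0 ?mulr_ge0//; lra.
  have := mulr_ge0 (sqr_ge0 k) lw1.
  by lra.
have [gg|gg] := leP gSc (3 * gS).
  (* In the cone 2 x <= lambda / 3 (gS + gSc) <= 4/3 lambda gS. *)
  have := le_amgm (4 / 3 * lambda) w30 (REg gg).
  have := h_le 2 (ler0n _ _).
  have : lambda * gSc <= lambda * (3 * gS) by rewrite ler_wpM2l.
  by lra.
(* Outside the cone gSc - gS >= (gS + gSc) / 2, so the left-hand side of [gKKT] is at least 3 x by
   [egle]; this is where the 6 in the noise level matters. *)
have : 2 * x <= - c.
  have : lambda * (3 * gS) <= lambda * gSc by rewrite ler_wpM2l// ltW.
  by lra.
(* [ABC] gives - c <= (a + b) / 2. Absorbing this doubles the term in h, hence k = 4; absorbing b /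
   2 once more produces the constant 16. *)
have := h_le 4 (ler0n _ _).
by lra.
Qed.

(** * Normal laws: affine images, convolution and tails *)

(** Packs the pushforward as a measure, with the measurability of [f] as an explicit argument. *)
Definition pushforward_measure d1 d2 (T1 : measurableType d1)
    (T2 : measurableType d2) (R : realType) (m : {measure set T1 -> \bar R})
    (f : T1 -> T2) (mf : measurable_fun setT f) : {measure set T2 -> \bar R} :=
  measure_function_pushforward__canonical__measure_function_Measure m mf.

Lemma measurable_affine (R : realType) (c a : R) :
  measurable_fun [set: measurableTypeR R]
    ((fun x => c + a * x) : measurableTypeR R -> measurableTypeR R).
Proof. by apply: measurable_funD => //; exact: measurable_funM. Qed.

(** By uniqueness of Lebesgue measure it suffices to compare half-open intervals. For a < 0 the
    preimage is closed on the other side, which does not change its length. *)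
Lemma lebesgue_measure_affine (R : realType) (c a : R) (A : set (measurableTypeR R)) :
  a != 0 -> measurable A ->
  lebesgue_measure A =
    (`|a|%:E * lebesgue_measure ((fun x => (c + a * x)%R) @^-1` A))%E.
Proof.
move=> a0 mA.
have mT := @measurable_affine R c a.
pose m := pushforward_measure lebesgue_measure mT.
apply: (lebesgue_measure_unique (mu := mscale (NngNum (normr_ge0 a)) m)) => //.
move=> _ [[u v] _ <-].
rewrite -[RHS]/(`|a|%:E * lebesgue_measure ((fun x => (c + a * x)%R) @^-1` `]u, v]))%E.
rewrite lebesgue_measure_itv/= lte_fin.
have [a_lt0|a_gt0|/eqP] := ltgtP a 0; last by rewrite (negbTE a0).
  rewrite (_ : _ @^-1` _ = `[(v - c) / a, (u - c) / a[%classic); last first.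
    apply/seteqP; split => x /=; rewrite !in_itv/= ler_ndivrMr// ltr_ndivlMr//; lra.
  rewrite lebesgue_measure_itv/= lte_fin.
  rewrite ltr_nM2r ?invr_lt0// ltrD2r; case: ifPn => _; last by rewrite mule0.
  by rewrite -!EFinD -EFinM ltr0_norm//; congr EFin; field.
rewrite (_ : _ @^-1` _ = `](u - c) / a, (v - c) / a]%classic); last first.
  apply/seteqP; split => x /=; rewrite !in_itv/= ltr_pdivrMr// ler_pdivlMr//; lra.
rewrite lebesgue_measure_itv/= lte_fin.
rewrite ltr_pM2r ?invr_gt0// ltrD2r; case: ifPn => _; last by rewrite mule0.
by rewrite -!EFinD -EFinM gtr0_norm//; congr EFin; field.
Qed.

(** Change of variables: |a| cancels against the normalising constant. The parameter [a * s] may be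
    negative, which is harmless since the density depends on its square only. *)
Lemma normal_prob_affine (R : realType) (m s c a : R) (B : set (measurableTypeR R)) :
  s != 0 -> a != 0 -> measurable B ->
  normal_prob m s ((fun x => c + a * x) @^-1` B) = normal_prob (c + a * m) (a * s) B.
Proof.
move=> s0 a0 mB; rewrite /normal_prob.
have mpdf : measurable_fun B (fun x : measurableTypeR R => (normal_pdf (c + a * m) (a * s) x)%:E).
  by apply/measurable_EFinP; apply/measurable_funTS; exact: measurable_normal_pdf.
rewrite [RHS](eq_measure_integral (mscale (NngNum (normr_ge0 a))
    (pushforward_measure lebesgue_measure (@measurable_affine R c a)))); last first.
  by move=> A mA _; exact: lebesgue_measure_affine.
rewrite ge0_integral_mscale//; last by move=> x _; rewrite lee_fin normal_pdf_ge0.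
rewrite ge0_integral_pushforward//=; last 2 first.
- exact: measurable_affine.
- by move=> x _; rewrite lee_fin normal_pdf_ge0.
rewrite -ge0_integralZl//; last 3 first.
- by rewrite -[X in measurable X]setTI; exact: (@measurable_affine R c a).
- apply/measurable_EFinP; apply/measurable_funTS.
  by apply: measurableT_comp; [exact: measurable_normal_pdf|exact: measurable_affine].
- by move=> x _; rewrite lee_fin normal_pdf_ge0.
apply: eq_integral => x _; rewrite -EFinM; congr EFin.
rewrite !normal_pdfE ?mulf_neq0// /normal_peak/normal_fun.
have -> : (a * s) ^+ 2 * pi *+ 2 = a ^+ 2 * (s ^+ 2 * pi *+ 2) by ring.
rewrite sqrtrM ?sqr_ge0// sqrtr_sqr invfM !mulrA divff ?normr_eq0// mul1r.
congr (_ * expR _); field.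
by rewrite s0 a0.
Qed.

(** The Radon-Nikodym derivative of the normal law agrees almost everywhere with its density, as
    both have the same integral over every measurable set. The bounds on [f] give integrability. *)
Lemma integral_normal_prob (R : realType) (m s : R) (f : R -> \bar R) :
  measurable_fun [set: measurableTypeR R] f -> (forall x, 0 <= f x <= 1)%E ->
  (\int[normal_prob m s]_x f x =
   \int[lebesgue_measure]_x (f x * (normal_pdf m s x)%:E))%E.
Proof.
move=> mf f01.
have intf : (normal_prob m s).-integrable setT f.
  apply/integrableP; split=> //.
  apply: (@le_lt_trans _ _ (\int[normal_prob m s]_x 1)%E).
    apply: ge0_le_integral => //; first exact: measurableT_comp.
    by move=> x _; have /andP[f0 f1] := f01 x; rewrite gee0_abs.
  by rewrite integral_cst// mul1e (le_lt_trans (probability_le1 _ _))// ltry.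
rewrite -(Radon_Nikodym_change_of_variables (normal_prob_dominates m s))//.
apply: ae_eq_integral => //.
- apply: emeasurable_funM => //; apply: (measurable_int lebesgue_measure).
  by apply: Radon_Nikodym_integrable; exact: normal_prob_dominates.
- apply: emeasurable_funM => //; apply/measurable_EFinP.
  exact: measurable_normal_pdf.
- apply: ae_eqe_mul2l => /=.
  rewrite Radon_NikodymE//=; first exact: normal_prob_dominates.
  move=> dom; case: cid => /= h [h1 h2 h3].
  apply: integral_ae_eq => //=.
  + by apply/measurable_EFinP; exact: measurable_normal_pdf.
  + by move=> E _ mE; rewrite -h3.
Qed.

(* Completing the square in [x]. *)
Lemma normal_pdf_conv (R : realType) (v w x y : R) : v != 0 -> w != 0 ->
  let u := Num.sqrt (v ^+ 2 + w ^+ 2) in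
  normal_pdf x w y * normal_pdf 0 v x =
  normal_pdf 0 u y * normal_pdf (y * v ^+ 2 / u ^+ 2) (v * w / u) x.
Proof.
move=> v0 w0 u.
have u2 : u ^+ 2 = v ^+ 2 + w ^+ 2 by rewrite sqr_sqrtr// addr_ge0 ?sqr_ge0.
have U0 : v ^+ 2 + w ^+ 2 != 0.
  by rewrite gt_eqF// ltr_pwDl ?sqr_ge0// exprn_even_gt0.
have u0 : u != 0 by move: U0; rewrite -u2 sqrf_eq0.
have r0 : v * w / u != 0 by rewrite !mulf_neq0 ?invr_eq0.
rewrite !normal_pdfE// mulrACA [RHS]mulrACA; congr (_ * _).
  rewrite /normal_peak -!invfM -!sqrtrM; last 2 first.
    by rewrite mulrn_wge0// mulr_ge0 ?sqr_ge0 ?pi_ge0.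
    by rewrite mulrn_wge0// mulr_ge0 ?sqr_ge0 ?pi_ge0.
  by congr (Num.sqrt _)^-1; field.
rewrite /normal_fun -!expRD !exprMn !exprVn u2; congr expR; field.
by rewrite U0 v0 w0.
Qed.

Lemma measurable_normal_pdf2 (R : realType) (w : R) : w != 0 ->
  measurable_fun [set: measurableTypeR R * measurableTypeR R]
    (fun z : measurableTypeR R * measurableTypeR R => normal_pdf z.1 w z.2).
Proof.
move=> w0.
rewrite (_ : (fun z => _) = (fun z => normal_pdf 0 w (z.2 - z.1))).
  apply: measurableT_comp; first exact: measurable_normal_pdf.
  by apply: measurable_funB; [exact: measurable_snd|exact: measurable_fst].
by apply/funext => z; rewrite !normal_pdfE// /normal_fun subr0.
Qed.

Lemma normal_probE (R : realType) (m s : R) (B : set (measurableTypeR R)) :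
  normal_prob m s B =
  (\int[lebesgue_measure]_y (normal_pdf m s y * \1_B y)%:E)%E.
Proof.
rewrite /normal_prob integral_mkcond; apply: eq_integral => y _.
by rewrite patchE indicE; case: ifP; rewrite ?mulr1// mulr0.
Qed.

Lemma measurable_normal_pdf2_indic (R : realType) (w : R)
    (B : set (measurableTypeR R)) : w != 0 -> measurable B ->
  measurable_fun [set: measurableTypeR R * measurableTypeR R]
    (fun z : measurableTypeR R * measurableTypeR R =>
      normal_pdf z.1 w z.2 * \1_B z.2).
Proof.
move=> w0 mB; apply: measurable_funM; first exact: measurable_normal_pdf2.
by apply: measurableT_comp => //; exact: measurable_snd.
Qed.

Lemma measurable_normal_prob_mean (R : realType) (w : R)
    (B : set (measurableTypeR R)) : w != 0 -> measurable B ->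
  measurable_fun [set: measurableTypeR R]
    (fun x : measurableTypeR R => normal_prob x w B).
Proof.
move=> w0 mB.
pose f (z : measurableTypeR R * measurableTypeR R) : \bar R :=
  (normal_pdf z.1 w z.2 * \1_B z.2)%:E.
rewrite (_ : (fun x => _) = fubini_F lebesgue_measure f).
  apply: measurable_fun_fubini_tonelli_F.
    by apply/measurable_EFinP; exact: measurable_normal_pdf2_indic.
  by move=> z; rewrite lee_fin mulr_ge0 ?normal_pdf_ge0.
by apply/funext => x; rewrite normal_probE.
Qed.

(** This is the law of a sum of two independent centered normals. After Tonelli and completion of
    the square, the inner integral is the total mass of a normal density. *)
Lemma normal_prob_conv (R : realType) (v w : R) (B : set (measurableTypeR R)) :
  v != 0 -> w != 0 -> measurable B ->
  (\int[normal_prob 0 v]_x normal_prob x w B =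
   normal_prob 0 (Num.sqrt (v ^+ 2 + w ^+ 2)) B)%E.
Proof.
move=> v0 w0 mB; set u := Num.sqrt _.
rewrite integral_normal_prob//; last 2 first.
- exact: measurable_normal_prob_mean.
- by move=> x; rewrite measure_ge0 probability_le1.
pose g (z : measurableTypeR R * measurableTypeR R) : \bar R :=
  (normal_pdf z.1 w z.2 * \1_B z.2 * normal_pdf 0 v z.1)%:E.
have mg : measurable_fun setT g.
  apply/measurable_EFinP; apply: measurable_funM; first exact: measurable_normal_pdf2_indic.
  by apply: measurableT_comp; [exact: measurable_normal_pdf|exact: measurable_fst].
have g0 z : (0 <= g z)%E by rewrite lee_fin !mulr_ge0 ?normal_pdf_ge0.
transitivity (\int[lebesgue_measure]_x \int[lebesgue_measure]_y g (x, y))%E.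
  apply: eq_integral => x _; rewrite normal_probE -ge0_integralZr//.
  - apply/measurable_EFinP/measurable_funM; first exact: measurable_normal_pdf.
    exact: measurable_indic.
  - by move=> y _; rewrite lee_fin mulr_ge0 ?normal_pdf_ge0.
  - by rewrite lee_fin normal_pdf_ge0.
rewrite (fubini_tonelli (m1 := lebesgue_measure) (m2 := lebesgue_measure))// normal_probE.
apply: eq_integral => y _.
transitivity (\int[lebesgue_measure]_x ((normal_pdf 0 u y * \1_B y)%:E *
    (normal_pdf (y * v ^+ 2 / u ^+ 2) (v * w / u) x)%:E))%E.
  apply: eq_integral => x _; rewrite /g/= -EFinM; congr EFin.
  by rewrite mulrAC normal_pdf_conv// mulrAC.
rewrite ge0_integralZl//; last 3 first.
- by apply/measurable_EFinP; exact: measurable_normal_pdf.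
- by move=> x _; rewrite lee_fin normal_pdf_ge0.
- by rewrite lee_fin mulr_ge0 ?normal_pdf_ge0.
by rewrite integral_normal_pdf mule1.
Qed.

(* On each half-line beyond c = t or c = -t, c (x - c) >= 0 bounds the centered
   density by exp (- t^2 / (2 s^2)) times the density centered at c; the two
   half-lines shifted back to the origin are disjoint. *)
Lemma normal_prob_tail (R : realType) (s t : R) : s != 0 -> 0 <= t ->
  (normal_prob 0 s [set x | (t < `|x|)%R] <=
   (expR (- t ^+ 2 / (s ^+ 2 *+ 2)))%:E)%E.
Proof.
move=> s0 t0; set E := expR _.
have half (c : R) (D : set (measurableTypeR R)) : measurable D ->
    (forall x, D x -> 0 <= c * (x - c)) -> c ^+ 2 = t ^+ 2 ->
    (normal_prob 0 s D <= E%:E * normal_prob 0 s ((fun x => c + 1 * x)%R @^-1` D))%E.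
  move=> mD Dc ct; rewrite normal_prob_affine ?oner_eq0// mulr0 addr0 mul1r.
  rewrite /normal_prob -ge0_integralZl//; last 3 first.
  - by apply/measurable_EFinP/measurable_funTS; exact: measurable_normal_pdf.
  - by move=> x _; rewrite lee_fin normal_pdf_ge0.
  - by rewrite lee_fin expR_ge0.
  apply: ge0_le_integral => //.
  - by move=> x _; rewrite lee_fin normal_pdf_ge0.
  - by apply/measurable_EFinP/measurable_funTS; exact: measurable_normal_pdf.
  - apply/measurable_EFinP/measurable_funM => //.
    by apply/measurable_funTS; exact: measurable_normal_pdf.
  move=> x Dx; rewrite -EFinM lee_fin !normal_pdfE// mulrCA ler_wpM2l ?normal_peak_ge0//.
  rewrite /normal_fun /E -expRD ler_expR -mulrDl ler_pM2r; last first.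
    by rewrite invr_gt0 mulrn_wgt0// exprn_even_gt0.
  by rewrite -ct; have := Dc _ Dx; nra.
have tailE : [set x : measurableTypeR R | t < `|x|] =
    `]t, +oo[%classic `|` `]-oo, (- t)[%classic.
  apply/seteqP; split => x /=; rewrite !in_itv/= andbT ltr_normr (ltrNr t) => /orP; tauto.
have mp : measurable (`]t, +oo[%classic : set (measurableTypeR R)) by exact: measurable_itv.
have mn : measurable (`]-oo, (- t)[%classic : set (measurableTypeR R)) by exact: measurable_itv.
rewrite tailE (le_trans (measureU2 _ _ _))//.
have := half t _ mp _ erefl; have := half (- t) _ mn _ (sqrrN _).
set N := normal_prob 0 s.
move=> hn hp; rewrite (le_trans (leeD (hp _) (hn _)))//.
- by move=> x /=; rewrite in_itv/= andbT => tx; rewrite mulr_ge0// subr_ge0 ltW.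
- by move=> x /=; rewrite in_itv/= => tx; rewrite mulr_le0// ?oppr_le0// subr_le0 ltW.
rewrite -ge0_muleDr// -[leRHS]mule1 lee_wpmul2l ?lee_fin ?expR_ge0//.
have mt c (D : set (measurableTypeR R)) : measurable D ->
    measurable ((fun x : measurableTypeR R => c + 1 * x : measurableTypeR R) @^-1` D).
  by move=> mD; rewrite -[X in measurable X]setTI; exact: (@measurable_affine R _ _).
rewrite -measureU.
- by apply: probability_le1; apply: measurableU; exact: mt.
- exact: mt.
- exact: mt.
- by apply/seteqP; split => x //=; rewrite !in_itv/= andbT => -[]; lra.
Qed.

(** * Linear combinations of independent normal variables *)

(* [normal_prob 0 0] is the library's junk value, the uniform law on [0, 1]. *)
Definition centered_normal (R : realType) (s : R) :
    probability (measurableTypeR R) R :=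
  if s == 0 then (dirac (0 : measurableTypeR R) : probability _ R)
  else normal_prob 0 s : probability _ R.

Lemma centered_normal0 (R : realType) (B : set (measurableTypeR R)) :
  centered_normal 0 B = \d_(0 : measurableTypeR R) B.
Proof. by rewrite /centered_normal eqxx. Qed.

(** Adds one independent term to a partial sum. Coefficients may be zero and the empty sum has
    variance 0, so a = 0 and v = 0 are treated apart; there the square root is an absolute value, on
    which the law does not depend up to sign. *)
Lemma centered_normal_conv (R : realType) (v w a : R) (B : set (measurableTypeR R)) :
  w != 0 -> measurable B ->
  (\int[centered_normal v]_x normal_prob 0 w ((fun y => (x + a * y)%R) @^-1` B) =
   centered_normal (Num.sqrt (v ^+ 2 + (a * w) ^+ 2)) B)%E.
Proof.
move=> w0 mB.
have [->|a0] := eqVneq a 0.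
  under eq_integral => x _.
    rewrite (_ : _ @^-1` _ = if x \in B then setT else set0); last first.
      case: ifPn => [/set_mem Bx|/negP xB]; apply/seteqP; split => y //=;
        by rewrite mul0r addr0// => Bx; apply: xB; exact/mem_set.
    rewrite (_ : normal_prob _ _ _ = (\1_B x)%:E); last first.
      rewrite indicE; case: (x \in B); first exact: probability_setT.
      exact: measure0.
    over.
  rewrite mul0r expr0n/= addr0 sqrtr_sqr integral_indic// setIT.
  rewrite /centered_normal normr_eq0; case: ifPn => // v0.
  by rewrite /normal_prob; apply: eq_integral => x _;
    rewrite !normal_pdfE ?normr_eq0// /normal_peak /normal_fun real_normK ?num_real.
under eq_integral => x _ do rewrite normal_prob_affine// mulr0 addr0.
have [->|v0] := eqVneq v 0.
  rewrite /centered_normal eqxx expr0n/= add0r sqrtr_sqr normr_eq0.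
  rewrite mulf_eq0 (negbTE a0) (negbTE w0)/= integral_dirac//; last first.
    by apply: measurable_normal_prob_mean => //; rewrite mulf_neq0.
  rewrite diracT mul1e.
  by rewrite /normal_prob; apply: eq_integral => x _;
    rewrite !normal_pdfE ?normr_eq0 ?mulf_neq0// /normal_peak /normal_fun real_normK ?num_real.
rewrite /centered_normal (negbTE v0) normal_prob_conv ?mulf_neq0//.
rewrite sqrtr_eq0 leNgt ltr_pwDr ?sqr_ge0//=.
by rewrite exprn_even_gt0//= mulf_neq0.
Qed.

(* The coordinates indexed by [K], not yet summed, are carried along to make
   the induction on [r] go through. *)
Lemma lin_comb_joint_law d (T : measurableType d) (R : realType)
    (P : probability T R) (n : nat) (sigma : R) (Z : 'I_n -> {RV P >-> R})
    (a : 'I_n -> R) (r : seq 'I_n) (K : {set 'I_n})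
    (B : set (measurableTypeR R)) (C : 'I_n -> set R) :
  sigma != 0 -> isotropic_gaussian sigma Z ->
  uniq r -> (forall i, i \in r -> i \notin K) ->
  measurable B -> (forall i, measurable (C i)) ->
  P ([set w | B (\sum_(i <- r) a i * Z i w)] `&`
     \bigcap_(i in [set i | i \in K]) (Z i @^-1` C i)) =
  (centered_normal (Num.sqrt (\sum_(i <- r) (a i * sigma) ^+ 2)) B *
   P (\bigcap_(i in [set i | i \in K]) (Z i @^-1` C i)))%E.
Proof.
move=> sigma0 Zgauss.
pose S r w : measurableTypeR R := \sum_(i <- r) a i * Z i w.
pose E (J : {set 'I_n}) (G : 'I_n -> set R) :=
  \bigcap_(i in [set i | i \in J]) (Z i @^-1` G i).
have mS u : measurable_fun setT (S u).
  by apply: measurable_sum => i; exact: measurable_funM.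
have mE (J : {set 'I_n}) (G : 'I_n -> set R) :
    (forall i, measurable (G i)) -> measurable (E J G).
  move=> mG; apply: fin_bigcap_measurable => // i _.
  by rewrite -[X in measurable X]setTI; exact: measurable_funPT.
rewrite -[[set w | _]]/(S r @^-1` B) -/(E K C).
elim: r K B C => [|i r IH] K B C /= ur rK mB mC.
  rewrite big_nil sqrtr0 centered_normal0 diracE.
  have S0 w : S [::] w = 0 by rewrite /S big_nil.
  case: (boolP (0 \in B)) => [/set_mem B0|/negP B0].
    rewrite mul1e; congr (P _); apply/seteqP; split => w; first by case.
    by move=> Ew; split => //=; rewrite S0.
  rewrite mul0e -[RHS](measure0 P); congr (P _).
  by apply/seteqP; split => w // -[/=]; rewrite S0 => B0'; case: B0; exact/mem_set.
move: ur => /andP[ir ur].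
have mEK := mE K C mC.
pose phi w : measurableTypeR R * measurableTypeR R := (S r w, Z i w).
have mphi : measurable_fun setT phi.
  by apply/measurable_fun_pairP; split; [exact: mS|exact: (measurable_funPT (Z i))].
(* Joint law of the partial sum and the next coordinate on the event [E K C], not normalised. Once
   it factors on rectangles it is a product measure, and integrating over sections leaves a
   convolution. *)
pose m' := pushforward_measure (mrestr P mEK) mphi.
pose c : {nonneg R} := NngNum (fine_ge0 (measure_ge0 P (E K C))).
pose law := centered_normal (Num.sqrt (\sum_(i <- r) (a i * sigma) ^+ 2)).
have rect A D : measurable A -> measurable D ->
    m' (A `*` D) = (mscale c law A * normal_prob 0 sigma D)%E.
  move=> mA mD.
  rewrite -[LHS]/(P (phi @^-1` (A `*` D) `&` E K C)).
  rewrite -[mscale _ _ _]/((fine (P (E K C)))%:E * law A)%E.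
  rewrite fineK ?fin_num_measure//.
  (* The constraint on the new coordinate joins the carried event, so the induction hypothesis
     applies with i added to [K]; independence then splits it off again. *)
  pose C' j := if j == i then D else C j.
  have mC' j : measurable (C' j).
    by rewrite /C'; case: ifP => _; [exact: mD|exact: mC].
  have -> : phi @^-1` (A `*` D) `&` E K C = S r @^-1` A `&` E (i |: K)%SET C'.
    apply/seteqP; split => w /=.
      move=> [[/= Sw Zw] Ew]; split => // j /=; rewrite !inE /C'.
      by case: eqP => [->//|_ /= jK]; exact: Ew.
    move=> [Sw Ew]; split; first split => //=.
      by have := Ew i; rewrite /= !inE eqxx /C' eqxx; exact.
    move=> j /= jK; have := Ew j; rewrite /= !inE jK orbT /C' => /(_ isT).
    by case: eqP => // ji; have := rK i; rewrite -ji jK inE eqxx => /(_ isT).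
  rewrite IH//; last first.
    move=> j jr; rewrite !inE negb_or rK ?inE ?jr ?orbT// andbT.
    by apply: contraNneq ir => <-.
  rewrite /E !Zgauss.1// big_setU1/=; last by rewrite rK// inE eqxx.
  rewrite {1}/C' eqxx (eq_bigr (fun j => P (Z j @^-1` C j))); last first.
    move=> j jK; rewrite /C'; case: eqP => // ji.
    by have := rK i; rewrite -ji jK inE eqxx => /(_ isT).
  by rewrite -(Zgauss.2 i D mD) muleA muleC muleA.
pose X := [set z : measurableTypeR R * measurableTypeR R | B (z.1 + a i * z.2)].
have mX : measurable X.
  rewrite -[X]setTI.
  apply: (_ : measurable_fun setT
    (fun z : measurableTypeR R * measurableTypeR R =>
      z.1 + a i * z.2 : measurableTypeR R)) => //.
  apply: measurable_funD; first exact: measurable_fst.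
  by apply: measurable_funM => //; exact: measurable_snd.
transitivity (m' X).
  rewrite -[RHS]/(P (phi @^-1` X `&` E K C)); congr (P (_ `&` _)).
  by apply/seteqP; split => w; rewrite /X /= /S big_cons addrC.
rewrite -(product_measure_unique (m1 := mscale c law) (m2 := normal_prob 0 sigma) rect)//.
rewrite /product_measure1/= ge0_integral_mscale//; last first.
  exact: measurable_fun_xsection.
under eq_integral => x _.
  rewrite (_ : xsection X x = (fun y => (x + a i * y)%R) @^-1` B); last first.
    by apply/seteqP; split => y; rewrite /xsection /= inE.
  over.
rewrite centered_normal_conv// sqr_sqrtr; last by apply: sumr_ge0 => j _; exact: sqr_ge0.
rewrite big_cons addrC muleC; congr (_ * _)%E.
by rewrite /= fineK// fin_num_measure.
Qed.

Lemma lin_comb_law d (T : measurableType d) (R : realType) (P : probability T R)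
    (n : nat) (sigma : R) (Z : 'I_n -> {RV P >-> R}) (a : 'I_n -> R)
    (B : set (measurableTypeR R)) :
  sigma != 0 -> isotropic_gaussian sigma Z -> measurable B ->
  P [set w | B (\sum_(i < n) a i * Z i w)] =
  centered_normal (Num.sqrt (\sum_(i < n) (a i * sigma) ^+ 2)) B.
Proof.
move=> sigma0 gZ mB.
have rK (i : 'I_n) : i \in index_enum 'I_n -> i \notin finset.set0.
  by rewrite finset.in_set0.
have E0 : \bigcap_(i in [set i | i \in (finset.set0 : {set 'I_n})]) Z i @^-1` setT = setT.
  by rewrite -subTset => w _ i /=.
have := lin_comb_joint_law a sigma0 gZ (index_enum_uniq 'I_n) rK mB
  (fun=> measurableT).
by rewrite E0 setIT probability_setT mule1.
Qed.

(** * Probability of the noise event and conclusion *)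

Lemma union_bound d (T : measurableType d) (R : realType) (P : probability T R)
    (I : finType) (A : I -> set T) (q : R) :
  (forall i, measurable (A i)) -> (forall i, (P (~` A i) <= q%:E)%E) ->
  ((1 - #|I|%:R * q)%:E <= P (\big[setI/setT]_i A i))%E.
Proof.
move=> mA Aq.
suff [mS le_S] : measurable (\big[setI/setT]_i A i) /\
    (P (~` \big[setI/setT]_i A i) <= (\sum_(i : I) q)%:E)%E.
  move: le_S; rewrite probability_setC// sumr_const mulr_natl EFinB.
  have PS := fin_num_measure P _ mS.
  by rewrite leeBlDr// leeBlDr// addeC.
elim/big_rec2 : _ => [|i s S _ [mS le_S]].
  by split; [exact: measurableT|rewrite setCT measure0].
split; first exact: measurableI.
rewrite setCI EFinD (le_trans (measureU2 _ _ _))//; [exact: measurableC..|].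
by apply: leeD; [exact: Aq|exact: le_S].
Qed.

Lemma trmx_mul_rvecE d (T : measurableType d) (R : realType)
    (P : probability T R) (n p : nat) (X : 'M[R]_(n, p))
    (eps : 'I_n -> {RV P >-> R}) (j : 'I_p) (w : T) :
  (X^T *m rvec eps w) j 0 = \sum_(i < n) X i j * eps i w.
Proof. by rewrite mxE; apply: eq_bigr => i _; rewrite !mxE. Qed.

Lemma measurable_trmx_mul_rvec d (T : measurableType d) (R : realType)
    (P : probability T R) (n p : nat) (X : 'M[R]_(n, p))
    (eps : 'I_n -> {RV P >-> R}) (j : 'I_p) :
  measurable_fun setT (fun w => (X^T *m rvec eps w) j 0).
Proof.
rewrite (_ : (fun w => _) = (fun w => \sum_(i < n) X i j * eps i w)).
  by apply: measurable_sum => i; exact: measurable_funM.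
by apply/funext => w; rewrite trmx_mul_rvecE.
Qed.

(** The column normalisation makes the variance n sigma^2 for every j, so all columns share one tail
    bound. *)
Lemma gaussian_noise_tail d (T : measurableType d) (R : realType)
    (P : probability T R) (n p : nat) (X : 'M[R]_(n, p)) (sigma : R)
    (eps : 'I_n -> {RV P >-> R}) (j : 'I_p) (t : R) :
  (0 < n)%N -> 0 < sigma -> isotropic_gaussian sigma eps ->
  l2norm (col j X) ^+ 2 = n%:R -> 0 <= t ->
  (P [set w | (t < `|(X^T *m rvec eps w) j 0|)%R] <=
    (expR (- t ^+ 2 / (n%:R * sigma ^+ 2 *+ 2)))%:E)%E.
Proof.
move=> n0 sigma0 geps Xj t0.
have n0' : 0 < n%:R :> R by rewrite ltr0n.
pose B := [set x : measurableTypeR R | t < `|x|].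
have mB : measurable B.
  rewrite (_ : B = ~` `[- t, t]%classic); first by apply: measurableC; exact: measurable_itv.
  by apply/seteqP; split => x; rewrite /B /= in_itv/= -ler_norml ltNge => /negP.
rewrite (_ : [set w | _] = [set w | B (\sum_(i < n) X i j * eps i w)]); last first.
  by apply/funext => w; rewrite /B/= trmx_mul_rvecE.
rewrite (lin_comb_law (fun i => X i j) (lt0r_neq0 sigma0) geps mB).
have -> : \sum_(i < n) (X i j * sigma) ^+ 2 = n%:R * sigma ^+ 2.
  rewrite -Xj sqr_l2norm /dot mulr_suml; apply: eq_bigr => i _.
  by rewrite !mxE exprMn expr2.
set s := Num.sqrt _.
have s2 : s ^+ 2 = n%:R * sigma ^+ 2 by rewrite sqr_sqrtr// mulr_ge0 ?sqr_ge0.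
have s0 : s != 0 by rewrite gt_eqF// sqrtr_gt0 mulr_gt0 ?exprn_gt0.
by rewrite /centered_normal (negbTE s0) -s2; exact: normal_prob_tail.
Qed.

Unset Implicit Arguments.

Theorem theorem3 (R : realType) (d : measure_display) (T : measurableType d)
  (P : probability T R) (n p s : nat)
  (X : 'M[R]_(n, p)) (betastar : 'cV[R]_p) (sigma : R)
  (eps : 'I_n -> {RV P >-> R}) (delta lambda kappa3 kappa1 : R)
  (betahat betabar : T -> 'cV[R]_p)
  (n_gt0 : (0 < n)%N)
  (s_range : (1 <= s <= p)%N)
  (X_cols : forall j : 'I_p, l2norm (col j X) ^+ 2 = n%:R)
  (card_supp : #|supp betastar| = s)
  (sigma_gt0 : 0 < sigma)
  (eps_gauss : isotropic_gaussian sigma eps)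
  (RE3 : RE_with X 3 s kappa3)
  (RE1 : RE_with X 1 s kappa1)
  (delta_range : 0 < delta < 1)
  (lambdaE : lambda = 6 * sigma * Num.sqrt (2 * ln (p%:R / delta) / n%:R))
  (hat_lasso : forall w : T,
     lasso_solution X (X *m betastar + rvec eps w) lambda (betahat w))
  (bar_refit : forall w : T,
     sign_consistent_refitting X (X *m betastar + rvec eps w) lambda
       (betahat w) (betabar w)) :
  with_prob_at_least P (1 - delta)
    [set w : T |
      1 / n%:R * l2norm (X *m (betastar - betabar w)) ^+ 2
      + 1 / n%:R * l2norm (X *m (betastar - betahat w)) ^+ 2
      <= lambda ^+ 2 * s%:R * (9 / kappa3 ^+ 2 + 16 / kappa1 ^+ 2)].

Proof.
have n0' : 0 < n%:R :> R by rewrite ltr0n.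
have [s_gt0 sp] := andP s_range.
have p0 : 0 < p%:R :> R by rewrite ltr0n (leq_trans s_gt0).
have [delta0 delta1] := andP delta_range.
(* Here delta < 1 <= p. As [Num.sqrt] is 0 on negative numbers, squaring lambda back relies on this
   sign. *)
have L0 : 0 <= ln (p%:R / delta).
  rewrite ln_ge0// ler_pdivlMr// mul1r (le_trans (ltW delta1))//.
  by rewrite ler1n (leq_trans s_gt0).
have lambda0 : 0 <= lambda by rewrite lambdaE !mulr_ge0 ?sqrtr_ge0// ltW.
pose t := n%:R * lambda / 6.
pose A j := [set w | `|(X^T *m rvec eps w) j 0| <= t].
have AC j : ~` A j = [set w | t < `|(X^T *m rvec eps w) j 0|].
  by apply/seteqP; split => w /=; rewrite ltNge => /negP.
have mA j : measurable (A j).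
  rewrite (_ : A j = (fun w => (X^T *m rvec eps w) j 0) @^-1` `[- t, t]%classic).
    by rewrite -[X in measurable X]setTI; exact: measurable_trmx_mul_rvec.
  by apply/seteqP; split => w; rewrite /A /= in_itv/= -ler_norml.
(* This event depends on the noise alone, hence is measurable however the solutions are selected. *)
exists (\big[setI/setT]_(j < p) A j); last first.
  (* The budget delta is split evenly over the columns: t^2 = 2 n sigma^2 ln (p / delta), so each
     tail is at most delta / p. *)
  rewrite (_ : delta = #|'I_p|%:R * (delta / p%:R)); last first.
    by rewrite card_ord mulrCA divff ?mulr1// gt_eqF.
  apply: union_bound => // j; rewrite AC.
  apply: le_trans (gaussian_noise_tail n_gt0 sigma_gt0 eps_gauss (X_cols j) _) _.
    by rewrite divr_ge0// mulr_ge0.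
  rewrite lee_fin (_ : - _ / _ = - ln (p%:R / delta)).
    by rewrite expRN lnK ?posrE ?divr_gt0// invf_div.
  rewrite /t lambdaE !exprMn sqr_sqrtr; last by rewrite divr_ge0// mulr_ge0.
  by field; rewrite !gt_eqF.
split; first exact: bigsetI_measurable.
move=> w Aw /=.
apply: refitting_bound n_gt0 s_gt0 card_supp lambda0 RE3 RE1 (hat_lasso w) (bar_refit w) _.
by move=> j; have := Aw; rewrite (bigD1 j)//= => -[].
Qed.
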